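(* Let $H\colon R\to S$ be a profunctor between categories. For each $s\in\mathrm{Ob}(S)$, let $\lim s\in\mathrm{Ob}(R)$ together with $\lambda_s\in H(\lim s,s)$ be a limit of $s$. Then $\lim$ extends uniquely to a functor $S\to R$ such that for each arrow $a\colon s'\to s$ in $S$ one has $$(\lim a)^*(\lambda_s)=a_*(\lambda_{s'})\quad\text{in }H(\lim s',s).$$
   Context: A profunctor $H\colon R\to S$ between categories is a functor $R^{\mathrm{op}}\times S\to\mathrm{SET}$, where $\mathrm{SET}$ is the category of sets (in a fixed universe). An element $h\in H(r,s)$ is called a heteromorphism $h\colon r\to s$. For arrows $a\colon r'\to r$ in $R$ and $b\colon s\to s'$ in $S$ write $a^*(h)=H(a,s)(h)\in H(r',s)$ and $b_*(h)=H(r,b)(h)\in H(r,s')$. A heteromorphism $h\colon r\to s$ (equivalently, the pair $(r,h)$) is a limit of $s$ if for every object $r'\in R$ and every $k\in H(r',s)$ there is a unique arrow $a\colon r'\to r$ with $a^*(h)=k$. *)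

(* Defs.v *)
Set Implicit Arguments.
Unset Strict Implicit.
Unset Printing Implicit Defensive.

Record category := Category {
  Ob :> Type;
  Hom : Ob -> Ob -> Type;
  idc : forall x, Hom x x;
  comp : forall x y z, Hom y z -> Hom x y -> Hom x z;
  comp_idl : forall x y (f : Hom x y), comp (idc y) f = f;
  comp_idr : forall x y (f : Hom x y), comp f (idc x) = f;
  comp_assoc : forall x y z t (h : Hom z t) (g : Hom y z) (f : Hom x y),
    comp h (comp g f) = comp (comp h g) f
}.

Arguments Hom {c} x y.
Arguments idc {c} x.
Arguments comp {c x y z} g f.

(* A functor is split into its object map and the rest of the structure, so
   that "the object map F0 extends to a functor" is the type
   [functor_on C D F0], with no equality between object maps to transport
   along. *)
Record functor_on (C D : category) (F0 : C -> D) := FunctorOn {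
  fmap : forall x y : C, Hom x y -> Hom (F0 x) (F0 y);
  fmap_id : forall x : C, fmap (idc x) = idc (F0 x);
  fmap_comp : forall (x y z : C) (g : Hom y z) (f : Hom x y),
    fmap (comp g f) = comp (fmap g) (fmap f)
}.

Arguments functor_on C D F0 : clear implicits.
Arguments fmap {C D F0} _ {x y} _.

Record functor (C D : category) := Functor {
  fob :> C -> D;
  fstr : functor_on C D fob
}.

Definition op (C : category) : category :=
  @Category (Ob C) (fun x y => @Hom C y x) (@idc C)
    (fun x y z g f => comp f g)
    (fun x y f => comp_idr f) (fun x y f => comp_idl f)
    (fun x y z t h g f => eq_sym (comp_assoc f g h)).

Definition prod_category (C D : category) : category.
Proof.
refine (@Category (Ob C * Ob D)%type
  (fun x y => (@Hom C (fst x) (fst y) * @Hom D (snd x) (snd y))%type)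
  (fun x => (idc (fst x), idc (snd x)))
  (fun x y z g f => (comp (fst g) (fst f), comp (snd g) (snd f))) _ _ _).
- intros x y [f1 f2]; cbn; now rewrite !comp_idl.
- intros x y [f1 f2]; cbn; now rewrite !comp_idr.
- intros x y z t h g f; cbn; now rewrite !comp_assoc.
Defined.

(* Sets are the types of one fixed universe; equality of functions and of
   elements is Leibniz equality. *)
Definition SET : category :=
  @Category Type (fun A B => A -> B) (fun A x => x)
    (fun A B C g f x => g (f x))
    (fun A B f => eq_refl) (fun A B f => eq_refl)
    (fun A B C D h g f => eq_refl).

Definition profunctor (R S : category) := functor (prod_category (op R) S) SET.

Section Heteromorphisms.
Variables (R S : category) (H : profunctor R S).

Definition het (r : R) (s : S) : Type := fob H (r, s).

(* pull a h is a^*(h), and push b h is b_*(h). *)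
Definition pull (r' r : R) (s : S) (a : Hom r' r) (h : het r s) : het r' s :=
  @fmap _ _ _ (fstr H) (r, s) (r', s) (a, idc s) h.

Definition push (r : R) (s s' : S) (b : Hom s s') (h : het r s) : het r s' :=
  @fmap _ _ _ (fstr H) (r, s) (r, s') (idc r, b) h.

Definition is_limit (r : R) (s : S) (h : het r s) : Prop :=
  forall (r' : R) (k : het r' s), exists! a : Hom r' r, pull a h = k.

End Heteromorphisms.

Arguments het {R S} H r s.
Arguments pull {R S} H {r' r s} a h.
Arguments push {R S} H {r s s'} b h.
Arguments is_limit {R S} H {r s} h.

(* Main.v *)
Require Import Defs.
From Stdlib Require Import ClassicalEpsilon FunctionalExtensionality ProofIrrelevance.

(** The arrow [lim a] is the unique one solving the required equation, so
    uniqueness is immediate; functoriality holds because [id] and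
    [lim b o lim a] solve the equations for [id] and [b o a], as pulling back
    and pushing forward commute with each other. *)

Section Heteromorphisms.
Variables (R S : category) (H : profunctor R S).

Lemma pull_id (r : R) (s : S) (h : het H r s) : pull H (idc r) h = h.
Proof.
exact (f_equal (fun f => f h) (fmap_id (fstr H) (r, s))).
Qed.

Lemma push_id (r : R) (s : S) (h : het H r s) : push H (idc s) h = h.
Proof.
exact (f_equal (fun f => f h) (fmap_id (fstr H) (r, s))).
Qed.

Lemma pull_comp (r'' r' r : R) (s : S) (a : Hom r' r) (a' : Hom r'' r')
    (h : het H r s) :
  pull H (comp a a') h = pull H a' (pull H a h).
Proof.
pose proof (f_equal (fun f => f h)
  (@fmap_comp _ _ _ (fstr H) (r, s) (r', s) (r'', s) (a', idc s) (a, idc s)))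
  as E; cbn in E.
rewrite comp_idl in E; exact E.
Qed.

Lemma push_comp (r : R) (s s' s'' : S) (b' : Hom s' s'') (b : Hom s s')
    (h : het H r s) :
  push H (comp b' b) h = push H b' (push H b h).
Proof.
pose proof (f_equal (fun f => f h)
  (@fmap_comp _ _ _ (fstr H) (r, s) (r, s') (r, s'') (idc r, b') (idc r, b)))
  as E; cbn in E.
rewrite comp_idl in E; exact E.
Qed.

(** Both sides are the action of the single arrow [(a, b)] of the product category, factored in its
    two possible orders. *)
Lemma pull_push (r' r : R) (s s' : S) (a : Hom r' r) (b : Hom s s')
    (h : het H r s) :
  pull H a (push H b h) = push H b (pull H a h).
Proof.
pose proof (f_equal (fun f => f h)
  (@fmap_comp _ _ _ (fstr H) (r, s) (r, s') (r', s') (a, idc s') (idc r, b)))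
  as E1.
pose proof (f_equal (fun f => f h)
  (@fmap_comp _ _ _ (fstr H) (r, s) (r', s) (r', s') (idc r', b) (a, idc s)))
  as E2.
cbn in E1, E2.
(* Composition in [op R] is reversed, so the identities stand on the left in both components of [E1]
   and on the right in both components of [E2]. *)
rewrite comp_idl, comp_idl in E1; rewrite comp_idr, comp_idr in E2.
exact (eq_trans (eq_sym E1) E2).
Qed.

(** The uniqueness half of the limit property: both arrows solve the equation for [pull H b h]. *)
Lemma limit_hom_ext (r : R) (s : S) (h : het H r s) :
  is_limit H h ->
  forall (r' : R) (a b : Hom r' r), pull H a h = pull H b h -> a = b.
Proof.
intros limh r' a b E.
destruct (limh r' (pull H b h)) as [c [_ uniq]].
now rewrite <- (uniq a E), <- (uniq b eq_refl).
Qed.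

End Heteromorphisms.

(** Turns uniqueness on arrows into the Leibniz equality that [exists!] asks for; the functor laws
    are identified by proof irrelevance. *)
Lemma functor_on_ext (C D : category) (F0 : C -> D) (F G : functor_on C D F0) :
  (forall (x y : C) (f : Hom x y), fmap F f = fmap G f) -> F = G.
Proof.
destruct F as [f fid fcomp], G as [g gid gcomp]; cbn; intros E.
assert (Efg : f = g).
{ do 3 (apply functional_extensionality_dep; intro); apply E. }
subst g.
now rewrite (proof_irrelevance _ fid gid), (proof_irrelevance _ fcomp gcomp).
Qed.

Theorem corollary6p3 (R S : category) (H : profunctor R S)
    (lim : S -> R) (lambda : forall s : S, het H (lim s) s)
    (lambda_limit : forall s : S, is_limit H (lambda s)) :
  exists! L : functor_on S R lim,
    forall (s' s : S) (a : Hom s' s),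
      pull H (fmap L a) (lambda s) = push H a (lambda s').
Proof.
assert (lift : forall (s' s : S) (a : Hom s' s),
  {l : Hom (lim s') (lim s) | pull H l (lambda s) = push H a (lambda s')}).
(* The limit property gives mere existence, in [Prop]; a functor needs the arrow as data, hence this
   choice. *)
{ intros s' s a; apply constructive_indefinite_description.
  destruct (lambda_limit s (lim s') (push H a (lambda s'))) as [l [El _]].
  now exists l. }
pose (lmap := fun s' s a => proj1_sig (lift s' s a)).
assert (lmapE : forall s' s a,
  pull H (lmap s' s a) (lambda s) = push H a (lambda s')).
{ intros s' s a; exact (proj2_sig (lift s' s a)). }
assert (lmap_id : forall s, lmap s s (idc s) = idc (lim s)).
{ intros s; apply (limit_hom_ext _ _ _ _ _ _ (lambda_limit s)).
  now rewrite lmapE, push_id, pull_id. }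
assert (lmap_comp : forall (x y z : S) (g : Hom y z) (f : Hom x y),
  lmap x z (comp g f) = comp (lmap y z g) (lmap x y f)).
{ intros x y z g f; apply (limit_hom_ext _ _ _ _ _ _ (lambda_limit z)).
  (* [pull_push] moves [push H g] outside, so that the equation for [f] applies to [lambda y]. *)
  now rewrite pull_comp, !lmapE, pull_push, lmapE, push_comp. }
exists (@FunctorOn S R lim lmap lmap_id lmap_comp); split.
- exact lmapE.
- intros L EL; apply functor_on_ext; intros s' s a.
  apply (limit_hom_ext _ _ _ _ _ _ (lambda_limit s)).
  now rewrite EL; apply lmapE.
Qed.
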